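(* Let $G$ be a connected finite graph on at least three vertices such that every ball of radius $3$ in $G$ is $2$-connected and $d(x)+d(y)+d(z)\ge |M_3(v)|+2$ for every vertex $v\in V(G)$ and for all triples $x,y,z$ of pairwise non-adjacent (in $G$) vertices of $G_2(v)$. Then every longest cycle of $G$ is dominating.
   Context: Graphs have no loops or multiple edges; $d(w)$ is the degree of $w$ in $G$. $M_r(u)$ is the set of vertices at distance at most $r$ from $u$ in $G$, and the ball $G_r(u)$ is the subgraph of $G$ induced by $M_r(u)$. A cycle $C$ of $G$ is dominating if $V(G)\setminus V(C)$ is an independent set. *)

(* Defs.v *)
(* A finite simple graph is a symmetric irreflexive relation
   [e] on its finite type of vertices [T]. *)
From mathcomp Require Import all_boot.

Set Implicit Arguments.
Unset Strict Implicit.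
Unset Printing Implicit Defensive.

Section Graph.
Variables (T : finType) (e : rel T).

Definition deg (x : T) : nat := #|[set y | e x y]|.

(* [n] counts the edges of the path [u :: p]. *)
Definition dist_le (r : nat) (u v : T) : bool :=
  [exists n : 'I_r.+1, [exists p : n.-tuple T,
     [&& path e u p, uniq (u :: p) & last u p == v]]].

Definition ball (r : nat) (u : T) : {set T} := [set v | dist_le r u v].

(* Adjacency of the subgraph induced by [A]; an induced subgraph is represented
   by its vertex set. *)
Definition induced (A : {set T}) : rel T :=
  [rel x y | [&& x \in A, y \in A & e x y]].

Definition connected_on (A : {set T}) : Prop :=
  {in A &, forall x y, connect (induced A) x y}.

Definition k_connected_on (k : nat) (A : {set T}) : Prop :=
  k < #|A| /\
  forall S : {set T}, S \subset A -> #|S| < k -> connected_on (A :\: S).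

(* The size bound is needed since [ucycle] also accepts the empty sequence and
   an edge traversed back and forth. *)
Definition is_cycle (c : seq T) : Prop := ucycle e c /\ 2 < size c.

Definition longest_cycle (c : seq T) : Prop :=
  is_cycle c /\ forall c' : seq T, is_cycle c' -> size c' <= size c.

Definition dominating (c : seq T) : Prop :=
  forall x y : T, x \notin c -> y \notin c -> ~~ e x y.

End Graph.

(* Main.v *)
Require Import Defs.
From mathcomp Require Import all_boot.
From mathcomp Require Import zify.

(* Let c be a longest cycle, H a component of G - c with an edge, X(x) the set
   of neighbours on c of x in H, and z+ the successor of z on c.  For distinct
   neighbours v, w of H on c, a path through H from w to v turns c into a path
   from v+ to w+, and the usual crossing argument bounds d(v+) + d(w+) by
   |M_3(o) \ H|.  The argument only uses vertices next to N(w+), so it stays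
   inside M_3(o) if w+ is in M_1(o) and v+ in M_2(o).  When v+ and w+ have a
   common neighbour one can take o = w+; when they have none, the bound holds
   trivially for every o with both in M_2(o).  Compared with the degree sum of
   a vertex x of H, v+ and w+, either case gives |X(x)| >= 3, and more if
   successors of other neighbours of H lie near o.

   Applied with o = x, this shows that the vertices of X(x)+ pairwise have
   common neighbours, and then that X(x) and X(y) are disjoint for x <> y as
   soon as |X(y)| >= 2.  Since balls of radius 3 have no cut vertex, some
   |X(x)| >= 2, and this property spreads to the neighbours y of x in H.  For
   such adjacent x, y the triple x, v+, u with v in X(x), u in X(y) and centre x
   yields v, u with v+ in M_2(u); counting X(y)+ then gives |X(y)| > |X(y)|. *)

Set Implicit Arguments.
Unset Strict Implicit.
Unset Printing Implicit Defensive.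

(** * Cyclic successors in a sequence without repetitions *)

Section SeqNext.
Variable T : eqType.
Implicit Types (s w z : T) (q : seq T).

Lemma next_cat q1 q2 s w z :
  uniq (s :: q1 ++ z :: q2) -> last s q1 = w -> next (s :: q1 ++ z :: q2) w = z.
Proof.
move=> Uq; rewrite -cat_cons lastI => Ew; move: Uq.
rewrite -cat_cons lastI Ew cat_rcons => Uq.
by rewrite -(next_rot (size (belast s q1)) Uq) rot_size_cat /= eqxx.
Qed.

Lemma next_last s q : uniq (s :: q) -> next (s :: q) (last s q) = s.
Proof.
move=> Uq; rewrite -(next_rot (size (belast s q)) Uq) lastI -cats1.
by rewrite rot_size_cat; case: q {Uq} => [|a q] /=; rewrite eqxx.
Qed.

Lemma next_split s q w : uniq (s :: q) -> w \in s :: q -> w != last s q ->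
  exists q1 q2, q = q1 ++ next (s :: q) w :: q2 /\ last s q1 = w.
Proof.
move=> Uq wq; case/splitPl: wq Uq => q1 [|z q2] lq Uq.
  by rewrite cats0 lq eqxx.
by move=> _; exists q1, q2; rewrite (next_cat Uq lq).
Qed.

Lemma next_notin q w : w \notin q -> next q w = w.
Proof. by rewrite next_nth => /negPf ->. Qed.

(** Isolates an inner vertex [b] between its two neighbours on the path, so that a crossing can skip
    exactly [b]. *)
Lemma prev_next_split s q b : uniq (s :: q) -> b \in s :: q ->
    b != s -> b != last s q ->
  exists q1 q2, q = q1 ++ b :: next (s :: q) b :: q2
             /\ last s q1 = prev (s :: q) b.
Proof.
move=> Uq bq bs bl; set a := prev _ b.
have nab : next (s :: q) a = b by rewrite next_prev.
have aq : a \in s :: q by rewrite mem_prev.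
have al : a != last s q.
  by apply: contra_neq bs => al; rewrite -nab al next_last.
have [q1 [[|z q2] []]] := next_split Uq aq al; rewrite nab => Eq lq.
  by rewrite Eq last_cat eqxx in bl.
exists q1, q2; split=> //; rewrite {1}Eq; congr (_ ++ _ :: _ :: _).
have Eq' : q = rcons q1 b ++ z :: q2 by rewrite cat_rcons.
by rewrite Eq' (next_cat (w := b)) ?last_rcons // -Eq'.
Qed.

End SeqNext.

(** * Counting and connectivity tools *)

Lemma card_disjointU (T : finType) (A B : {set T}) :
  (forall z, z \in A -> z \notin B) -> #|A :|: B| = #|A| + #|B|.
Proof.
move=> AB; rewrite -cardsUI; suff -> : A :&: B = set0 by rewrite cards0 addn0.
by apply/setP => z; rewrite !inE; apply/negP => /andP[/AB/negP].
Qed.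

Lemma card_setD2 (T : finType) (A : {set T}) a b : #|A| <= #|A :\ a :\ b| + 2.
Proof.
rewrite (cardsD1 a) (cardsD1 b (A :\ a)) addnA addnC leq_add2l.
by case: in_mem; case: in_mem.
Qed.

Lemma connect_exit (T : finType) (r : rel T) (A : {set T}) x y :
    connect r x y -> x \in A -> y \notin A ->
  exists z z', [/\ r z z', z \in A & z' \notin A].
Proof.
case/connectP=> p + ->; elim: p x => [|z p IHp] x /= => [_ ->|] //.
case/andP=> xz pz xA; case: (boolP (z \in A)) => [|zA _]; first exact: IHp.
by exists x, z.
Qed.

(** * Walks and balls *)

Section Ball.
Variables (T : finType) (e : rel T) (e_sym : symmetric e).
Implicit Types (u v w : T) (r : nat).

(** Removing repetitions from a walk does not lengthen it, so walks suffice and can be concatenated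
    freely. *)
Lemma ballP r u v :
  reflect (exists p, [/\ path e u p, size p <= r & last u p = v])
          (v \in ball e r u).
Proof.
rewrite inE; apply: (iffP existsP) => [[n /existsP[p /and3P[pp _ /eqP lp]]]|].
  by exists p; rewrite size_tuple -ltnS.
case=> p [pp sp <-]; case/shortenP: pp => p' pp' Up' sub.
have sp' : size p' < r.+1.
  rewrite ltnS; apply: leq_trans sp; apply: uniq_leq_size => //.
  by case/andP: Up'.
exists (Ordinal sp'); apply/existsP; exists (in_tuple p').
by rewrite pp' Up' eqxx.
Qed.

Lemma ball_refl r u : u \in ball e r u.
Proof. by apply/ballP; exists [::]. Qed.

Lemma ball_mono r r' u v : r <= r' -> v \in ball e r u -> v \in ball e r' u.
Proof.
move=> rr /ballP[p [pp sp lp]]; apply/ballP; exists p; split=> //.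
exact: leq_trans rr.
Qed.

Lemma ball_step r u v w : v \in ball e r u -> e v w -> w \in ball e r.+1 u.
Proof.
case/ballP=> p [pp sp lp] vw; apply/ballP; exists (rcons p w).
by rewrite rcons_path pp lp vw size_rcons last_rcons.
Qed.

Lemma ball_sym r u v : v \in ball e r u -> u \in ball e r v.
Proof.
case/ballP=> p [pp sp <-]; apply/ballP; exists (rev (belast u p)); split.
- by rewrite rev_path; apply: sub_path pp => a b; rewrite /= e_sym.
- by rewrite size_rev size_belast.
- by case: p {pp sp} => //= a p; rewrite rev_cons last_rcons.
Qed.

Lemma ball0 u v : v \in ball e 0 u -> v = u.
Proof. by case/ballP=> -[|a p] [_ //= _ ->]. Qed.

Lemma ball_cons r u v : v \in ball e r.+1 u ->
  v = u \/ exists2 w, e u w & v \in ball e r w.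
Proof.
case/ballP=> -[|w p] /= [pp sp lp]; [by left | right].
by case/andP: pp => uw pp; exists w => //; apply/ballP; exists p.
Qed.

Lemma ball1 u v : e u v -> v \in ball e 1 u.
Proof. by apply: ball_step; apply: ball_refl. Qed.

Lemma ball2 u v w : e u v -> e v w -> w \in ball e 2 u.
Proof. by move=> /ball1; apply: ball_step. Qed.

Lemma ball3 u v w z : e u v -> e v w -> e w z -> z \in ball e 3 u.
Proof. by move=> uv /(ball2 uv); apply: ball_step. Qed.

End Ball.

(** * Rerouting a longest cycle through a component H off the cycle *)

Section LongestCycle.
Variables (T : finType) (e : rel T).
Hypotheses (e_sym : symmetric e) (e_irr : irreflexive e).
Variable c : seq T.
Hypothesis c_longest : longest_cycle e c.
Variable H : {set T}.
Hypothesis Hc : forall z, z \in H -> z \notin c.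
Hypothesis Hnbr : forall z w, z \in H -> e z w -> w \notin c -> w \in H.
Hypothesis Hpath : forall x y, x \in H -> y \in H -> exists p,
  [/\ path e x p, uniq (x :: p), last x p = y & {subset x :: p <= H}].

Local Notation N x := [set y | e x y].
Local Notation sc := (next c).

Let c_uniq : uniq c. Proof. by case: c_longest => -[/andP[]]. Qed.
Let c_cycle : cycle e c. Proof. by case: c_longest => -[/andP[]]. Qed.

(** One or two vertices do not form a cycle, but [c] has at least three, so the bound covers them
    too. *)
Lemma closed_path_size s q :
  path e s q -> uniq (s :: q) -> e (last s q) s -> (size q).+1 <= size c.
Proof.
move=> pq uq lq; have [[_ c2] maxc] := c_longest.
case: (ltnP 2 (size q).+1) => [q2|]; last by move/leq_trans; apply; apply: ltnW.
apply: (maxc (s :: q)); split=> //; rewrite /ucycle uq andbT /=.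
by rewrite rcons_path pq lq.
Qed.

(** The new cycle follows [s :: q1], jumps to the end of the path, comes back to [b] and closes at
    [s]; the segment [m] is left out. *)
Lemma crossing_size s q1 m b q2 :
    path e s (q1 ++ m ++ b :: q2) -> uniq (s :: q1 ++ m ++ b :: q2) ->
    e s b -> e (last s q1) (last b q2) ->
  (size (q1 ++ b :: q2)).+1 <= size c.
Proof.
move=> pq uq sb al.
have -> : size (q1 ++ b :: q2) = size (q1 ++ rev (b :: q2)).
  by rewrite !size_cat size_rev.
apply: (@closed_path_size s).
- move: pq; rewrite !cat_path => /and3P[-> _ /= /andP[_ pq2]] /=.
  have := rev_path e s (rcons (b :: q2) (last s q1)).
  rewrite last_rcons belast_rcons rev_cons => rp.
  have : path e (last s q1) (rcons (rev (b :: q2)) s).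
    rewrite rp /= rcons_path e_sym sb /=.
    rewrite [e _ (last b q2)]al andbT.
    by apply: sub_path pq2 => u w; rewrite /= e_sym.
  by rewrite rcons_path => /andP[].
- have : perm_eq (s :: q1 ++ m ++ b :: q2) (m ++ s :: q1 ++ rev (b :: q2)).
    rewrite -!cat_cons perm_sym perm_catCA perm_cat2l perm_cat2l.
    by rewrite perm_rev.
  by move/perm_uniq; rewrite uq cat_uniq => /esym/and3P[].
- by rewrite last_cat rev_cons last_rcons e_sym.
Qed.

Lemma succ_adj v : v \in c -> e v (sc v).
Proof. exact: next_cycle. Qed.

Lemma succ_in v : (sc v \in c) = (v \in c).
Proof. by rewrite mem_next. Qed.

Lemma succ_inj : injective sc.
Proof. exact: can_inj (prev_next c_uniq). Qed.

(** Otherwise a path of H from [x] to [y] fits between [v] and [sc v] and lengthens [c]. *)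
Lemma succ_notH v x y : v \in c -> x \in H -> e x v -> y \in H -> ~~ e y (sc v).
Proof.
move=> vc xH xv yH; apply/negP => ys.
have sc_c : sc v \in c by rewrite succ_in.
have [i q Eq] := rot_to sc_c.
have Uq : uniq (sc v :: q) by rewrite -Eq rot_uniq.
have Cq : cycle e (sc v :: q) by rewrite -Eq rot_cycle.
have lq : last (sc v) q = v.
  by apply: succ_inj; rewrite -(next_rot i c_uniq) Eq next_last.
move: Cq; rewrite /= rcons_path => /andP[pq _].
have [p [pp up lp pH]] := Hpath xH yH.
have := @closed_path_size (sc v) (q ++ x :: p).
rewrite cat_path pq lq /= [e v x]e_sym xv pp last_cat /= lp ys => /(_ isT).
rewrite -[_ && uniq _]/(uniq ((sc v :: q) ++ x :: p)) cat_uniq Uq up andbT.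
rewrite size_cat -addSn -[(size q).+1]/(size (sc v :: q)) -Eq size_rot /=.
move=> h; suff nh : ~~ has [in rot i c] (x :: p) 
  by move: (h nh isT); rewrite addnS ltnNge leq_addr.
by apply/hasPn => z /pH zH; rewrite /= mem_rot Hc.
Qed.

(** The path follows [c] from [sc v] to [v'], passes through H from [y] to [x], and runs backwards
    along [c] from [v] to [sc v']. It covers [c] and at least one vertex of H, two if [x != y], and
    it enters H only from [v']. *)
Lemma linking_path v v' x y :
    v \in c -> v' \in c -> v != v' -> x \in H -> y \in H -> e x v -> e y v' ->
  exists q, [/\ path e (sc v) q, uniq (sc v :: q), last (sc v) q = sc v',
    size c + (x != y) <= size q &
    forall w, next (sc v :: q) w \in H -> w \in H \/ w = v'].
Proof.
move=> vc v'c vv' xH yH xv yv'.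
have sc_c : sc v \in c by rewrite succ_in.
have sc'_c : sc v' \in c by rewrite succ_in.
have ss : sc v != sc v' by apply: contra_neq vv' => /succ_inj.
have [i p1 p2 _ _ Ec] := rot_to_arc c_uniq sc_c sc'_c ss.
have U : uniq (sc v :: p1 ++ sc v' :: p2) by rewrite -Ec rot_uniq.
have Cy : cycle e (sc v :: p1 ++ sc v' :: p2) by rewrite -Ec rot_cycle.
have mc z : (z \in c) = (z \in sc v :: p1) || (z \in sc v' :: p2).
  by rewrite -(mem_rot i) Ec -cat_cons mem_cat.
have l1 : last (sc v) p1 = v'.
  by apply: succ_inj; rewrite -(next_rot i c_uniq) Ec (next_cat U).
have l2 : last (sc v') p2 = v.
  apply: succ_inj; rewrite -(next_rot i c_uniq) Ec -[RHS](next_last U).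
  by rewrite last_cat.
have [p [pp up lp pH]] := Hpath yH xH.
exists (p1 ++ (y :: p) ++ rev (sc v' :: p2)).
have Uq : uniq (sc v :: p1 ++ (y :: p) ++ rev (sc v' :: p2)).
  have : perm_eq (sc v :: p1 ++ (y :: p) ++ rev (sc v' :: p2))
      ((y :: p) ++ (sc v :: p1 ++ sc v' :: p2)).
    rewrite -!cat_cons perm_catCA !perm_cat2l.
    by rewrite perm_rev.
  move/perm_uniq ->; rewrite cat_uniq up U andbT /=.
  rewrite -[X in ~~ X]/(has [in y :: p] (sc v :: p1 ++ sc v' :: p2)).
  apply/hasPn => z; rewrite -Ec mem_rot => zc.
  by apply: contraL zc => /pH; apply: Hc.
split=> //.
- move: Cy; rewrite /= rcons_path cat_path l1 => /andP[/= /and3P[P1 _ P2] _].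
  rewrite cat_path P1 l1 /= cat_path e_sym yv' pp lp /=.
  have := rev_path e (sc v') (rcons p2 x).
  rewrite last_rcons belast_rcons => ->.
  rewrite rcons_path l2 xv andbT.
  by apply: sub_path P2 => u w; rewrite /= e_sym.
- by rewrite !last_cat rev_cons last_rcons.
- rewrite !size_cat size_rev -(size_rot i c) Ec /= size_cat /=.
  case: (eqVneq x y) => [|xy] /=; first by clear; lia.
  by case: p {pp up pH Uq} lp => [/= yx|? ? _ /=];
    [rewrite yx eqxx in xy | clear; lia].
- move=> w; set Q := (X in next X _).
  case: (boolP (w \in Q)) => [wQ|/next_notin ->]; last by left.
  (* At the last vertex [next] wraps around to [sc v], which lies on [c]. *)
  case: (eqVneq w (last (sc v) (p1 ++ (y :: p) ++ rev (sc v' :: p2))))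
    => [->|wl].
    by rewrite next_last // => /Hc; rewrite sc_c.
  have : [|| w \in sc v :: p1, w \in y :: p | w \in rev (sc v' :: p2)].
    by move: wQ; rewrite /Q -cat_cons !mem_cat.
  case/or3P=> {wQ}[w1||w2].
  + move=> nw; right.
    case/splitPl: w1 mc Uq @Q l1 nw wl => a [|z a2] la mc Uq Q l1 nw wl.
      by rewrite cats0 in l1; rewrite -l1.
    move: nw; rewrite /Q -catA (next_cat (w := w)) //; last first.
      by move: Uq; rewrite -catA.
    by move=> /Hc; rewrite mc -cat_cons mem_cat mem_head orbT.
  + by move=> /pH; left.
  + move=> nw; have [a [b [Eq la]]] : exists a b,
      rev (sc v' :: p2) = a ++ next Q w :: b
       /\ last (last (sc v) (p1 ++ y :: p)) a = w.
      move: w2 Uq @Q nw wl; rewrite mem_rev catA.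
      rewrite -mem_rev; set R := rev _ => w2.
      have wR : w \in last (sc v) (p1 ++ y :: p) :: R by rewrite inE w2 orbT.
      case/splitPl: wR w2 => a [|z b] la w2 Uq Q nw wl.
        by rewrite cats0 last_cat la eqxx in wl.
      exists a, b; split=> //; congr (_ ++ _ :: _).
      by rewrite /Q catA; apply/esym/next_cat;
        [rewrite -catA | rewrite last_cat].
    have : next Q w \in rev (sc v' :: p2) by rewrite Eq mem_cat inE eqxx orbT.
    by rewrite mem_rev => nc; move/Hc: nw; rewrite mc nc orbT.
Qed.

(** An edge between its two ends would close the linking path into a cycle longer than [c]. *)
Lemma succ_nonadj v v' x y :
    v \in c -> v' \in c -> v != v' -> x \in H -> y \in H -> e x v -> e y v' ->
  ~~ e (sc v) (sc v').
Proof.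
move=> vc v'c vv' xH yH xv yv'; apply/negP => ss.
have [q [pq uq lq sq _]] := linking_path vc v'c vv' xH yH xv yv'.
have := closed_path_size pq uq; rewrite lq e_sym ss => /(_ isT).
by rewrite leqNgt ltnS (leq_trans _ sq) // leq_addr.
Qed.

Lemma path_next s q w : path e s q -> uniq (s :: q) ->
  w \in s :: q -> w != last s q -> e w (next (s :: q) w).
Proof.
move=> pq uq wq wl; have [q1 [q2 [Eq lw]]] := next_split uq wq wl.
by move: pq; rewrite {1}Eq cat_path lw /= => /and3P[].
Qed.

(** * Successors of attachments and the crossing count *)

Definition succs : {set T} := [set sc w | w in c & [exists z in H, e z w]].

Lemma succsP b :
  reflect (exists w z, [/\ w \in c, z \in H, e z w & b = sc w]) (b \in succs).
Proof.
apply: (iffP imsetP) => [[w]|[w [z [wc zH zw ->]]]]; rewrite ?inE.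
  case/andP=> wc /existsP[z /andP[zH zw]] ->; by exists w, z.
by exists w => //; rewrite inE wc; apply/existsP; exists z; rewrite zH.
Qed.

Lemma succs_nonadj b b' : b \in succs -> b' \in succs -> ~~ e b b'.
Proof.
case/succsP=> w [z [wc zH zw ->]] /succsP[w' [z' [w'c zH' zw' ->]]].
case: (eqVneq w w') => [->|ww']; first by rewrite e_irr.
exact: succ_nonadj ww' zH zH' zw zw'.
Qed.

Lemma succs_notH b y : b \in succs -> y \in H -> ~~ e y b.
Proof.
by case/succsP=> w [z [wc zH zw ->]] yH; apply: succ_notH zw yH.
Qed.

Lemma succs_in b : b \in succs -> b \in c.
Proof. by case/succsP=> w [z [wc _ _ ->]]; rewrite succ_in. Qed.

(* On a path q from s = sc v to t = sc v' through H, the successors of the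
   neighbours of t are not adjacent to s, since c is longest.  Each b in B brings
   one more vertex of neither kind: b itself, unless its predecessor on q is a
   neighbour of t; in that case the successor of b, which is not adjacent to s
   because q, having at least two vertices in H, can afford to skip b. *)
Lemma degree_count v v' x y o (B : {set T}) :
    v \in c -> v' \in c -> v != v' -> x \in H -> y \in H -> e x v -> e y v' ->
    sc v \in ball e 2 o -> sc v' \in ball e 1 o ->
    (x = y -> B = set0) ->
    (forall b, b \in B ->
      [/\ b \in succs, b \in ball e 2 o, b != sc v & b != sc v']) ->
  deg e (sc v) + deg e (sc v') + #|H :&: ball e 3 o| + #|B| <= #|ball e 3 o|.
Proof.
move=> vc v'c vv' xH yH xv yv'.
have [q [pq uq lq sq nH]] := linking_path vc v'c vv' xH yH xv yv'.
have s_succ : sc v \in succs by apply/succsP; exists v, x.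
have t_succ : sc v' \in succs by apply/succsP; exists v', y.
move: s_succ t_succ pq uq lq sq nH.
move: (sc v) (sc v') => s t sW tW pq uq lq sq nH so to Bxy Bo.
have cq : size c <= size q by apply: leq_trans sq; apply: leq_addr.
(* [phi] sends the last vertex [t] back to [s] and fixes every vertex off the path, so it is
   injective on all of [T]. *)
set Q := s :: q in nH; pose phi := next Q.
have phi_inj : injective phi by apply: can_inj (prev_next uq).
have phi_s w : phi w = s -> w = t.
  by rewrite -lq -{1}(next_last uq) => /phi_inj.
have st : ~~ e s t by apply: succs_nonadj.
have no_cross w : e t w -> ~~ e s (phi w).
  move=> tw; apply/negP; case: (boolP (w \in Q)) => [wQ|wQ].
    have wt : w != last s q by apply: contraL tw => /eqP->; rewrite lq e_irr.
    have [q1 [q2 [Eq lw]]] := next_split uq wQ wt => sw.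
    have /= := @crossing_size s q1 [::] (phi w) q2.
    rewrite -Eq => /(_ pq uq sw); rewrite lw.
    have -> : last (phi w) q2 = t by rewrite -lq Eq last_cat.
    by rewrite e_sym tw => /(_ isT); rewrite leqNgt ltnS cq.
  (* A common neighbour of [s] and [t] off the path would close it into a cycle longer than [c]. *)
  rewrite /phi next_notin // => sw.
  have := @closed_path_size s (rcons q w).
  rewrite rcons_path pq lq tw last_rcons e_sym sw.
  rewrite -rcons_cons rcons_uniq wQ uq => /(_ isT isT isT).
  by rewrite size_rcons leqNgt ltnS (leq_trans cq).
have phi_step w r : w \in ball e r o -> e t w -> phi w \in ball e r.+1 o.
  move=> wo tw; case: (boolP (w \in Q)) => [wQ|wQ]; last first.
    by rewrite /phi next_notin //; apply: ball_mono wo.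
  apply: ball_step wo _; apply: path_next => //.
  by apply: contraL tw => /eqP->; rewrite lq e_irr.
pose psi b := if e t (prev Q b) then phi b else b.
have psiP b : b \in B -> e t (prev Q b) ->
    [/\ e b (phi b), ~~ e s (phi b) & phi b != s].
  move=> bB tpb; have [bW bo bs bt] := Bo b bB.
  have bQ : b \in Q.
    apply: contraT => bQ; have := succs_nonadj tW bW.
    by rewrite -{1}[b](prev_next uq) -/Q next_notin // tpb.
  have bl : b != last s q by rewrite lq.
  have [q1 [q2 [Eq lw]]] := prev_next_split uq bQ bs bl.
  split; first exact: path_next.
    apply/negP=> sb.
    have /= := @crossing_size s q1 [:: b] (phi b) q2.
    rewrite -Eq => /(_ pq uq sb); rewrite lw.
    have -> : last (phi b) q2 = t by rewrite -lq Eq last_cat.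
    rewrite e_sym tpb => /(_ isT).
    have xy : x != y by apply: contraTneq bB => /Bxy ->; rewrite inE.
    have : size q = (size (q1 ++ phi b :: q2)).+1.
      by rewrite {1}Eq !size_cat /= addnS.
    move=> <-; rewrite leqNgt; apply/negP/negPn.
    by apply: leq_trans sq; rewrite xy addn1.
  by apply: contra_neq bt; apply: phi_s.
have psi_inj : {in B &, injective psi}.
  move=> b b' bB b'B; rewrite /psi; have [bW _ _ _] := Bo b bB.
  have [b'W _ _ _] := Bo b' b'B.
  case: ifP => tb; case: ifP => tb' //; first exact: phi_inj.
    have [ebb _ _] := psiP b bB tb => eb.
    by have := succs_nonadj bW b'W; rewrite -eb ebb.
  have [ebb _ _] := psiP b' b'B tb' => eb.
  by have := succs_nonadj b'W bW; rewrite eb ebb.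
set M := ball e 3 o.
(* Five pairwise disjoint subsets of [M] are counted. [A2] omits [v'], whose successor on the path
   may lie in H; the singleton of [s] makes up for this loss. *)
pose A1 := [set y | e s y]; pose A2 := phi @: ([set y | e t y] :\ v').
pose A4 := psi @: B.
have sM : s \in M by apply: ball_mono so.
have phiH w : e t w -> phi w \in H -> w = v'.
  move=> tw /nH[wH|//].
  by have := succs_notH tW wH; rewrite e_sym tw.
have sub : A1 :|: (A2 :|: (s |: (A4 :|: H :&: M))) \subset M.
  rewrite !subUset subsetIr andbT sub1set sM /=; apply/and3P; split.
  - by apply/subsetP => z; rewrite inE => sz; apply: ball_step so sz.
  - apply/subsetP => _ /imsetP[w /setD1P[_ +] ->]; rewrite inE => tw.
    exact: phi_step (ball_step to tw) tw.
  - apply/subsetP => _ /imsetP[b bB ->]; rewrite /psi.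
    have [bW bo bs bt] := Bo b bB; case: ifP => [tb|_].
      by have [ebb _ _] := psiP b bB tb; apply: ball_step bo ebb.
    exact: ball_mono bo.
have := subset_leq_card sub; apply: leq_trans.
rewrite !card_disjointU.
- rewrite cards1 card_imset // card_in_imset // /deg.
  have : #|[set y | e t y]| <= #|[set y | e t y] :\ v'| + 1.
    by rewrite (cardsD1 v') addnC leq_add2l leq_b1.
  rewrite /A1 -/M; move: #|_ :\ _| #|[set y | e s y]| #|[set y | e t y]|.
  by move: #|_ :&: _| #|B|; clear; lia.
- move=> _ /imsetP[b bB ->]; rewrite !inE negb_and; apply/orP; left.
  have [bW bo bs bt] := Bo b bB; rewrite /psi.
  case: ifP => [tb|_]; last by apply: contraL (succs_in bW); apply: Hc.
  have [ebb _ _] := psiP b bB tb; apply/negP => /nH[bH|bv].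
    by have := succs_in bW; rewrite (negPf (Hc bH)).
  by have := succs_notH bW yH; rewrite bv yv'.
- move=> z /set1P ->; rewrite !inE negb_or negb_and; apply/andP; split.
    apply/negP => /imsetP[b bB]; have [bW bo bs bt] := Bo b bB; rewrite /psi.
    case: ifP => [tb|_] /eqP; last by rewrite eq_sym (negPf bs).
    by have [_ _ /negPf] := psiP b bB tb; rewrite eq_sym => ->.
  by apply/orP; left; apply: contraL (succs_in sW); apply: Hc.
- move=> _ /imsetP[w + ->]; rewrite !inE => /andP[wv' tw].
  rewrite !negb_or; apply/and3P; split.
  + by apply: contraL tw => /eqP/phi_s->; rewrite e_irr.
  + apply/negP => /imsetP[b bB]; have [bW bo bs bt] := Bo b bB; rewrite /psi.
    case: ifP => [tb /phi_inj wb|/negP tb wb].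
      by have := succs_nonadj tW bW; rewrite -wb tw.
    by apply: tb; rewrite -wb prev_next.
  + by rewrite negb_and; apply/orP; left; apply: contra_neqN wv'; apply: phiH.
- move=> z; rewrite !inE => sz; rewrite !negb_or; apply/and4P; split.
  + by apply: contraL sz => /imsetP[w + ->]; rewrite !inE => /andP[_];
      apply: no_cross.
  + by apply: contraL sz => /eqP->; rewrite e_irr.
  + apply: contraL sz => /imsetP[b bB ->]; have [bW bo bs bt] := Bo b bB.
    rewrite /psi; case: ifP => [tb|_]; last exact: succs_nonadj.
    by have [] := psiP b bB tb.
  + rewrite negb_and; apply/orP; left; apply: contraL sz => zH.
    by rewrite e_sym; apply: succs_notH.
Qed.

(** * Consequences of the degree-sum condition *)

Hypothesis deg_sum : forall v x y z : T,
  x \in ball e 2 v -> y \in ball e 2 v -> z \in ball e 2 v ->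
  x != y -> x != z -> y != z -> ~~ e x y -> ~~ e x z -> ~~ e y z ->
  #|ball e 3 v| + 2 <= deg e x + deg e y + deg e z.

(** This is X(x) in the sketch of the proof. *)
Definition attach x : {set T} := [set w in c | e x w].

Lemma attachP x w : reflect (w \in c /\ e x w) (w \in attach x).
Proof. by rewrite inE; apply: andP. Qed.

Definition common s t := [exists z, e s z && e t z].

Lemma common_ball s t : common s t -> s \in ball e 2 t.
Proof. by case/existsP=> z /andP[sz tz]; apply: ball2 tz _; rewrite e_sym. Qed.

(** The neighbours of [x] lie in X(x) or in H without [x] itself; this last exclusion turns the 2 of
    [deg_sum] into 3. *)
Lemma degree_sum_outside x s t o : x \in H -> s \notin H -> t \notin H ->
    ~~ e x s -> ~~ e x t -> ~~ e s t -> s != t ->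
    x \in ball e 2 o -> s \in ball e 2 o -> t \in ball e 2 o ->
  #|ball e 3 o| + 3 <= deg e s + deg e t + #|H :&: ball e 3 o| + #|attach x|.
Proof.
move=> xH sH tH xs xt st neq xo so to.
have dneq z : z \notin H -> x != z by apply: contraNneq => <-.
have := deg_sum xo so to (dneq _ sH) (dneq _ tH) neq xs xt st.
have : deg e x + 1 <= #|H :&: ball e 3 o| + #|attach x|.
  have xHo : x \in H :&: ball e 3 o by rewrite inE xH; apply: ball_mono xo.
  rewrite (cardsD1 x) xHo addnC -addnA leq_add2l.
  apply: leq_trans (leq_card_setU _ _); apply/subset_leq_card/subsetP => w.
  rewrite inE => xw; have wo := ball_step xo xw.
  rewrite in_setU in_setD1 in_setI wo andbT.
  case: (boolP (w \in c)) => [wc|wc]; first by apply/orP; right; apply/attachP.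
  rewrite (Hnbr xH xw wc) andbT; apply/orP; left.
  by apply: contraL xw => /eqP->; rewrite e_irr.
by move: (deg e _) (deg e _) (deg e _) #|_| #|_| #|_|; clear; lia.
Qed.

(** Without a common neighbour, N(s), N(t) and [E] are pairwise disjoint parts of the ball. This
    replaces [degree_count] and needs no cycle argument. *)
Lemma degree_count_disjoint s t o (E : {set T}) :
    s \in ball e 2 o -> t \in ball e 2 o -> ~~ common s t ->
    (forall z, z \in E -> [/\ z \in ball e 3 o, ~~ e s z & ~~ e t z]) ->
  deg e s + deg e t + #|E| <= #|ball e 3 o|.
Proof.
move=> so to nst Eo; rewrite -addnA /deg -!card_disjointU.
- apply/subset_leq_card/subsetP => z /setUP[|/setUP[|/Eo[]//]].
    by rewrite inE; apply: ball_step.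
  by rewrite inE; apply: ball_step.
- move=> z; rewrite !inE negb_or => sz; apply/andP; split.
    by apply: contra nst => tz; apply/existsP; exists z; rewrite sz.
  by apply/negP => /Eo[_]; rewrite sz.
- by move=> z; rewrite inE => tz; apply/negP => /Eo[_ _]; rewrite tz.
Qed.

(** Compares the upper bound [degree_count] with the lower bound [degree_sum_outside] at the same
    centre; [a] may be any vertex of H near [o]. *)
Lemma attach_large v v' x y a o (B : {set T}) :
    v \in c -> v' \in c -> v != v' -> x \in H -> y \in H -> e x v -> e y v' ->
    a \in H -> a \in ball e 2 o ->
    sc v \in ball e 2 o -> sc v' \in ball e 1 o ->
    (x = y -> B = set0) ->
    (forall b, b \in B ->
      [/\ b \in succs, b \in ball e 2 o, b != sc v & b != sc v']) ->
  3 + #|B| <= #|attach a|.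
Proof.
move=> vc v'c vv' xH yH xv yv' aH ao so to Bxy Bo.
have := degree_count vc v'c vv' xH yH xv yv' so to Bxy Bo.
have sW : sc v \in succs by apply/succsP; exists v, x.
have tW : sc v' \in succs by apply/succsP; exists v', y.
have notH z : z \in succs -> z \notin H.
  by move/succs_in; apply: contraL; apply: Hc.
have ss : sc v != sc v' by apply: contra_neq vv' => /succ_inj.
have := degree_sum_outside aH (notH _ sW) (notH _ tW) (succs_notH sW aH)
  (succs_notH tW aH) (succs_nonadj sW tW) ss ao so (ball_mono _ to).
move=> /(_ isT); move: (deg e _) (deg e _) #|_| #|_| #|_| #|_|.
by clear; lia.
Qed.

(** Same comparison with [degree_count_disjoint]. Since [succs] is independent and has no edge to H,
    all of [B] and H can be counted; [B] may even contain [sc v] and [sc v']. *)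
Lemma attach_large_disjoint v v' x y a o (B : {set T}) :
    v \in c -> v' \in c -> v != v' -> x \in H -> y \in H -> e x v -> e y v' ->
    a \in H -> a \in ball e 2 o ->
    sc v \in ball e 2 o -> sc v' \in ball e 2 o -> ~~ common (sc v) (sc v') ->
    (forall b, b \in B -> b \in succs /\ b \in ball e 3 o) ->
  3 + #|B| <= #|attach a|.
Proof.
move=> vc v'c vv' xH yH xv yv' aH ao so to nst Bo.
have sW : sc v \in succs by apply/succsP; exists v, x.
have tW : sc v' \in succs by apply/succsP; exists v', y.
have notH z : z \in succs -> z \notin H.
  by move/succs_in; apply: contraL; apply: Hc.
have ss : sc v != sc v' by apply: contra_neq vv' => /succ_inj.
have := degree_sum_outside aH (notH _ sW) (notH _ tW) (succs_notH sW aH)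
  (succs_notH tW aH) (succs_nonadj sW tW) ss ao so to.
have := @degree_count_disjoint _ _ o (B :|: H :&: ball e 3 o) so to nst.
rewrite card_disjointU; last first.
  by move=> z /Bo[/notH zH _]; rewrite inE negb_and zH.
have Eo z : z \in B :|: H :&: ball e 3 o ->
    [/\ z \in ball e 3 o, ~~ e (sc v) z & ~~ e (sc v') z].
  case/setUP=> [/Bo[zW zo]|/setIP[zH zo]].
    by split=> //; apply: succs_nonadj.
  by split=> //; rewrite e_sym succs_notH.
move=> /(_ Eo); move: (deg e _) (deg e _) #|_| #|_| #|_| #|_|.
by clear; lia.
Qed.

(** * Comparing the attachments of different vertices of H *)

Definition attach_succs y : {set T} := sc @: attach y.

Lemma card_attach_succs y : #|attach_succs y| = #|attach y|.
Proof. by apply/card_imset/succ_inj. Qed.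

Lemma attach_succsP y b :
  reflect (exists2 w, w \in attach y & b = sc w) (b \in attach_succs y).
Proof. exact: imsetP. Qed.

Lemma attach_succs_sub y b : y \in H -> b \in attach_succs y -> b \in succs.
Proof.
by move=> yH /attach_succsP[w /attachP[wc yw] ->]; apply/succsP; exists w, y.
Qed.

Lemma attach_succs_ball y b : b \in attach_succs y -> b \in ball e 2 y.
Proof.
by case/attach_succsP=> w /attachP[wc yw] ->; apply: ball2 yw (succ_adj wc).
Qed.

(** Otherwise the disjoint count centred at [y], with all of X(y)+ as [B], gives 3 + |X(y)| <=
    |X(y)|. *)
Lemma common_succs y v v' : y \in H -> v \in attach y -> v' \in attach y ->
  v != v' -> common (sc v) (sc v').
Proof.
move=> yH vy v'y vv'; apply: contraT => nst.
have [[vc yv] [v'c yv']] := (attachP _ _ vy, attachP _ _ v'y).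
have := @attach_large_disjoint v v' y y y y (attach_succs y)
  vc v'c vv' yH yH yv yv' yH (ball_refl _ _ _).
rewrite !attach_succs_ball ?imset_f // => /(_ isT isT nst).
rewrite card_attach_succs leqNgt -[X in X < _]add0n ltn_add2r => h.
suff /h : forall b, b \in attach_succs y ->
  b \in succs /\ b \in ball e 3 y by [].
move=> b bY; split; first exact: attach_succs_sub bY.
exact: ball_mono (attach_succs_ball bY).
Qed.

Lemma attach_succs_near y b b' : y \in H ->
  b \in attach_succs y -> b' \in attach_succs y -> b \in ball e 2 b'.
Proof.
move=> yH /attach_succsP[w wY ->] /attach_succsP[w' w'Y ->].
case: (eqVneq w w') => [->|ww']; first exact: ball_refl.
exact/common_ball/(common_succs yH).
Qed.

(** A common neighbour would allow the centre [sc v'], which is near all of X(y)+. Taking out [sc v]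
    and [sc v'] costs at most 2, less than the 3 gained by [attach_large]. *)
Lemma attach_far x y v v' : x \in H -> y \in H -> x != y ->
    v \in attach x -> v' \in attach y -> v != v' ->
  ~~ common (sc v) (sc v').
Proof.
move=> xH yH xy vX v'Y vv'; apply/negP => cst.
have [[vc xv] [v'c yv']] := (attachP _ _ vX, attachP _ _ v'Y).
have yt : y \in ball e 2 (sc v').
  by apply: ball_sym => //; apply/attach_succs_ball/imset_f.
have := @attach_large v v' x y y (sc v') (attach_succs y :\ sc v :\ sc v')
  vc v'c vv' xH yH xv yv' yH yt (common_ball cst) (ball_refl _ _ _).
have no : x = y -> attach_succs y :\ sc v :\ sc v' = set0.
  by move=> Exy; rewrite Exy eqxx in xy.
move/(_ no); have B b : b \in attach_succs y :\ sc v :\ sc v' ->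
    [/\ b \in succs, b \in ball e 2 (sc v'), b != sc v & b != sc v'].
  case/setD1P=> bt /setD1P[bs bY]; split=> //; first exact: attach_succs_sub bY.
  by apply: (attach_succs_near yH bY); apply: imset_f.
move/(_ B); have := card_setD2 (attach_succs y) (sc v) (sc v').
rewrite card_attach_succs; move: #|_| #|_|; clear; lia.
Qed.

(** For a second vertex [v'] of X(y), [common_succs] and [attach_far] contradict each other on
    [sc v] and [sc v']. *)
Lemma attach_single x y v : x \in H -> y \in H -> x != y ->
  v \in attach x -> v \in attach y -> #|attach y| <= 1.
Proof.
move=> xH yH xy vX vY; rewrite leqNgt; apply/negP => Y1.
have [v' v'Y vv'] : exists2 v', v' \in attach y & v != v'.
  have [w [w' [wY w'Y ww']]] := card_gt1P Y1.
  by case: (eqVneq v w) => [->|vw]; [exists w' | exists w].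
by have := attach_far xH yH xy vX v'Y vv'; rewrite (common_succs yH vY v'Y vv').
Qed.

Lemma attach_private x z v : x \in H -> 1 < #|attach x| -> v \in attach x ->
  z \in H -> e z v -> z = x.
Proof.
move=> xH X1 vX zH zv; apply/eqP; apply: contraLR X1 => zx; rewrite -leqNgt.
have [vc _] := attachP _ _ vX.
by apply: (attach_single zH xH zx _ vX); apply/attachP.
Qed.

(** If [sc v] is near [v'], then [attach_large] applies with centre [v']. Otherwise [sc v] and [v']
    have no common neighbour, and the triple [y], [sc v], [v'] is used with centre [v]. *)
Lemma attach_neighbor x y : x \in H -> y \in H -> e x y ->
  1 < #|attach x| -> 1 < #|attach y|.
Proof.
move=> xH yH xy X1; have [v [v' [vX v'X vv']]] := card_gt1P X1.
have [[vc xv] [v'c xv']] := (attachP _ _ vX, attachP _ _ v'X).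
have [vx v'x] : e v x /\ e v' x by rewrite ![e _ x]e_sym.
case: (boolP (sc v \in ball e 2 v')) => sv'.
  have := @attach_large v v' x x y v' set0 vc v'c vv' xH xH xv xv' yH
    (ball2 v'x xy) sv' (ball1 (succ_adj v'c)) (fun _ => erefl).
  rewrite cards0 addn0 => h; apply: leq_trans (h _) => // b.
  by rewrite inE.
have sW : sc v \in succs by apply/succsP; exists v, x.
have notH w : w \in c -> w \notin H by apply: contraL; apply: Hc.
have sx_v' : ~~ e (sc v) v'.
  by apply: contra sv' => sv'; apply: ball_mono (ball1 _) => //; rewrite e_sym.
have s_v' : sc v != v'.
  by apply: contraTneq xv' => <-; apply: succs_notH.
have y_v' : ~~ e y v'.
  apply/negP => yv'; have := attach_private xH X1 v'X yH yv'.
  by move=> Eyx; rewrite Eyx e_irr in xy.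
have so : sc v \in ball e 2 v by apply: ball_mono (ball1 (succ_adj vc)).
have := degree_sum_outside yH (notH _ (succs_in sW)) (notH _ v'c)
  (succs_notH sW yH) y_v' sx_v' s_v' (ball2 vx xy) so (ball2 vx xv').
have nc : ~~ common (sc v) v' by apply: contra sv' => /common_ball.
(* By [attach_private], [x] is the only neighbour of [v'] in H, so it is the only vertex of H to be
   removed. *)
have := @degree_count_disjoint _ _ v
  ([set sc v; v'] :|: (H :&: ball e 3 v) :\ x) so (ball2 vx xv') nc.
rewrite card_disjointU; last first.
  move=> z zs; rewrite !inE !negb_and; suff /notH -> : z \in c by rewrite orbT.
  by case/set2P: zs => -> //; apply: succs_in.
rewrite cards2 s_v' => h.
have /h {h} : forall z, z \in [set sc v; v'] :|: (H :&: ball e 3 v) :\ x ->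
    [/\ z \in ball e 3 v, ~~ e (sc v) z & ~~ e v' z].
  move=> z /setUP[/set2P[]->|/setD1P[zx /setIP[zH zo]]].
  - by rewrite e_irr e_sym sx_v'; split=> //; apply: ball_mono so.
  - by rewrite e_irr sx_v'; split=> //; apply: ball_mono (ball2 vx xv').
  - split=> //; first by rewrite e_sym succs_notH.
    by apply: contraNN zx; rewrite e_sym => /(attach_private xH X1 v'X zH)->.
have : #|H :&: ball e 3 v| <= #|(H :&: ball e 3 v) :\ x| + 1.
  by rewrite (cardsD1 x) addnC leq_add2l leq_b1.
move: (deg e _) (deg e _) #|_| #|_| #|_| #|_|.
by clear; lia.
Qed.

Lemma attach_adjacent x y : x \in H -> y \in H -> e x y ->
  1 < #|attach x| -> 1 < #|attach y| -> False.
Proof.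
move=> xH yH xy X1 Y1.
have yx : e y x by rewrite e_sym.
have xNy : x != y by apply: contraTneq xy => ->; rewrite e_irr.
have notH w : w \in c -> w \notin H by apply: contraL; apply: Hc.
have [v [u [vX uY su]]] : exists v u,
    [/\ v \in attach x, u \in attach y & sc v \in ball e 2 u].
  case: (boolP [exists v in attach x, exists u in attach y,
    sc v \in ball e 2 u]).
    by case/existsP=> v /andP[vX /existsP[u /andP[uY su]]]; exists v, u.
  (* If no such pair exists, N(sc v), N(u), [u], X(x)+ and H without [y], the only neighbour of [u]
     in H, are disjoint around [x]; this contradicts the degree sum. *)
  rewrite negb_exists_in => /forall_inP far.
  have {}far v u : v \in attach x -> u \in attach y -> sc v \notin ball e 2 u.
    by move=> vX uY; move/far: vX; rewrite negb_exists_in => /forall_inP; apply.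
  have [v [_ [vX _ _]]] := card_gt1P X1; have [u [_ [uY _ _]]] := card_gt1P Y1.
  have [[vc xv] [uc yu]] := (attachP _ _ vX, attachP _ _ uY).
  have sW : sc v \in succs by apply/succsP; exists v, x.
  have x_u : ~~ e x u.
    by apply: contra_neqN xNy; apply: (attach_private yH Y1 uY xH).
  have Xu b : b \in attach_succs x -> ~~ e b u.
    case/attach_succsP=> w wX ->; apply: contra (far _ _ wX uY) => wu.
    by apply: ball_mono (ball1 _) => //; rewrite e_sym.
  have s_u : ~~ e (sc v) u by apply/Xu/imset_f.
  have sNu : sc v != u by apply: contraTneq yu => <-; apply: succs_notH.
  have so : sc v \in ball e 2 x by apply/attach_succs_ball/imset_f.
  have := degree_sum_outside xH (notH _ (succs_in sW)) (notH _ uc)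
    (succs_notH sW xH) x_u s_u sNu (ball_refl _ _ _) so (ball2 xy yu).
  have nc : ~~ common (sc v) u by apply: contra (far _ _ vX uY) => /common_ball.
  have := @degree_count_disjoint _ _ x
    (u |: (attach_succs x :|: (H :&: ball e 3 x) :\ y)) so (ball2 xy yu) nc.
  rewrite card_disjointU; last first.
    move=> z /set1P->; rewrite !inE !negb_or !negb_and (notH _ uc) orbT andbT.
    by apply: contraL yu => uX; apply/(succs_notH _ yH)/(attach_succs_sub xH).
  rewrite card_disjointU; last first.
    move=> z /(attach_succs_sub xH)/succs_in/notH zH.
    by rewrite !inE !negb_and zH orbT.
  rewrite cards1 card_attach_succs => h.
  have /h {h} : forall z,
      z \in u |: (attach_succs x :|: (H :&: ball e 3 x) :\ y) ->
      [/\ z \in ball e 3 x, ~~ e (sc v) z & ~~ e u z].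
    move=> z /setU1P[->|/setUP[zX|/setD1P[zy /setIP[zH zo]]]].
    - by rewrite e_irr; split=> //; apply: ball_mono (ball2 xy yu).
    - split; first exact: ball_mono (attach_succs_ball zX).
        exact/succs_nonadj/(attach_succs_sub xH).
      by rewrite e_sym Xu.
    - split=> //; first by rewrite e_sym succs_notH.
      by apply: contraNN zy; rewrite e_sym => /(attach_private yH Y1 uY zH)->.
  have : #|H :&: ball e 3 x| <= #|(H :&: ball e 3 x) :\ y| + 1.
    by rewrite (cardsD1 y) addnC leq_add2l leq_b1.
  move: (deg e _) (deg e _) #|_| #|_| #|_| #|_|.
  by clear; lia.
have [[vc xv] [uc yu]] := (attachP _ _ vX, attachP _ _ uY).
have vu : v != u.
  apply: contraNneq xNy => Evu; rewrite Evu in xv.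
  by rewrite (attach_private yH Y1 uY xH xv).
have uy : e u y by rewrite e_sym.
have nst := attach_far xH yH xNy vX uY vu.
(* With centre [u], the walks [u], [y], [w], [sc w] reach all of X(y)+, so that 3 + |X(y)| <=
   |X(y)|. *)
have := @attach_large_disjoint v u x y y u (attach_succs y)
  vc uc vu xH yH xv yu yH (ball_mono (isT : 1 <= 2) (ball1 uy)) su
  (ball_mono (isT : 1 <= 2) (ball1 (succ_adj uc))) nst.
rewrite card_attach_succs leqNgt -[X in X < _]add0n ltn_add2r => h.
suff /h : forall b, b \in attach_succs y ->
  b \in succs /\ b \in ball e 3 u by [].
move=> b bY; split; first exact: attach_succs_sub bY.
case/attach_succsP: bY => w /attachP[wc yw] ->.
exact: ball3 uy yw (succ_adj wc).
Qed.

(** * A vertex of H with two attachments, from 2-connected balls *)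

Hypothesis ball3_conn : forall u, k_connected_on e 2 (ball e 3 u).

(** If every X(y) had at most one element, [v] would separate [x] from [sc v] in the ball of radius
    3 around [x]. *)
Lemma attach_two v x : x \in H -> v \in c -> e x v ->
  exists2 y, y \in H & 1 < #|attach y|.
Proof.
move=> xH vc xv.
case: (boolP [exists y in H, 1 < #|attach y|]) => [/exists_inP//|].
rewrite negb_exists_in => /forall_inP small.
have {}small y : y \in H -> #|attach y| <= 1 by move/small; rewrite -leqNgt.
have vx : e v x by rewrite e_sym.
have sW : sc v \in succs by apply/succsP; exists v, x.
have notH w : w \in c -> w \notin H by apply: contraL; apply: Hc.
(* Otherwise [attach_large] centred at [sc w], or [attach_large_disjoint] centred at [o], gives
   |X(a)| >= 3. *)
have far w a o : w \in c -> v != w -> a \in H -> e a w -> o \in ball e 1 w ->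
    sc v \notin ball e 2 o.
  move=> wc vw aH aw /(ball_sym e_sym) ow; apply/negP => so.
  have wa : e w a by rewrite e_sym.
  case: (boolP (common (sc v) (sc w))) => [cst|nst].
    have := @attach_large v w x a a (sc w) set0 vc wc vw xH aH xv aw aH.
    have aw2 : a \in ball e 2 (sc w).
      by apply: ball_sym => //; apply: ball2 aw (succ_adj wc).
    move/(_ aw2 (common_ball cst) (ball_refl _ _ _) (fun _ => erefl)) => h.
    suff /h : forall b, b \in set0 -> [/\ b \in succs, b \in ball e 2 (sc w),
      b != sc v & b != sc w] by
      rewrite cards0 leqNgt ltnS (leq_trans (small a aH)).
    by move=> b; rewrite inE.
  have := @attach_large_disjoint v w x a a o set0 vc wc vw xH aH xv aw aH
    (ball_step ow wa) so (ball_step ow (succ_adj wc)) nst.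
  move=> h; suff /h : forall b, b \in set0 -> b \in succs /\ b \in ball e 3 o
    by rewrite cards0 leqNgt ltnS (leq_trans (small a aH)).
  by move=> b; rewrite inE.
pose att z := [exists h in H, e h z].
(* [A] collects H, its neighbours, and the neighbours on or off [c] of attachments other than [v].
   It contains [x] but not [sc v], so some edge from [z] to [z'] in the ball without [v] leaves
   it. *)
pose A := [set z | [|| z \in H, att z
  | [exists w in c, [&& v != w, att w & e w z]]]].
have sA : sc v \notin A.
  rewrite inE !negb_or (notH _ (succs_in sW)) /=; apply/andP; split.
    by rewrite /att negb_exists_in; apply/forall_inP => h hH; apply: succs_notH.
  rewrite negb_exists_in; apply/forall_inP => w wc; apply/negP.
  case/and3P=> vw /exists_inP[h hH hw] ws.
  have := far w h w wc vw hH hw (ball_refl _ _ _).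
  by rewrite (ball_mono _ (ball1 ws)).
have xA : x \in A by rewrite inE xH.
have [_ /(_ [set v])] := ball3_conn x.
rewrite sub1set cards1 (ball_mono _ (ball1 xv)) // => /(_ isT isT).
have xD : x \in ball e 3 x :\: [set v].
  by rewrite in_setD ball_refl andbT inE; apply: contraTneq vc => <-; apply: Hc.
have sD : sc v \in ball e 3 x :\: [set v].
  rewrite in_setD (ball_mono _ (ball2 xv (succ_adj vc))) // andbT inE.
  by apply: contraTneq (succ_adj vc) => ->; rewrite e_irr.
move/(_ _ _ xD sD)=> /connect_exit/(_ xA sA).
case=> z; case=> z'; case=> /and3P[zD z'D zz'] zA z'A.
have {z'A} [z'H z'att z'far] : [/\ z' \notin H, forall h, h \in H -> ~~ e h z'
    & forall w h, w \in c -> v != w -> h \in H -> e h w -> ~~ e w z'].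
  move: z'A; rewrite inE !negb_or !negb_exists_in.
  case/and3P=> z'H /forall_inP z'att /forall_inP z'far.
  split=> // w h wc vw hH hw.
  have := z'far w wc; rewrite vw /=; apply: contra => -> //.
  by rewrite andbT; apply/exists_inP; exists h.
have {zD} [zv zo] : z != v /\ z \in ball e 3 x.
  by move: zD; rewrite in_setD inE => /andP[].
have {z'D} [z'v z'o] : z' != v /\ z' \in ball e 3 x.
  by move: z'D; rewrite in_setD inE => /andP[].
have {zA} [zH zatt [w [h [wc vw hH hw wz]]]] : [/\ z \notin H,
    forall h, h \in H -> ~~ e h z
    & exists w h, [/\ w \in c, v != w, h \in H, e h w & e w z]].
  case: (boolP (z \in H)) => zH; first by have := z'att z zH; rewrite zz'.
  case: (boolP (att z)) => zatt.
    case/exists_inP: zatt => h hH hz.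
    have zc : z \in c by apply: contraNT zH; apply: Hnbr hH hz.
    by have := z'far z h zc; rewrite eq_sym zz' => /(_ zv hH hz).
  move: zA; rewrite inE (negPf zH) (negPf zatt) /= => /exists_inP[w wc].
  case/and3P=> vw /exists_inP[h hH hw] wz; split=> //.
    by move: zatt; rewrite negb_exists_in => /forall_inP.
  by exists w, h.
(* A walk [x], [a], [b], [z'] must leave H at [a] or [b], as [z'] is neither in H nor next to it.
   The exit is [v]: at [a] because X(x) has one element, at [b] because [z'] is next to no other
   attachment. *)
have z'v2 : z' \in ball e 2 v.
  case/ball_cons: z'o => [Ez'|[a xa z'a]]; first by rewrite Ez' xH in z'H.
  case: (boolP (a \in H)) => aH; last first.
    have ac : a \in c by apply: contraNT aH; apply: Hnbr xH xa.
    have aX : a \in attach x by apply/attachP.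
    have vX : v \in attach x by apply/attachP.
    by rewrite (card_le1_eqP (small x xH) a v aX vX).
  case/ball_cons: z'a => [Ez'|[b ab z'b]]; first by rewrite Ez' aH in z'H.
  case/ball_cons: z'b => [Ez'|[b' bb' /ball0 Ez']].
    by have := z'att a aH; rewrite Ez' ab.
  rewrite -Ez' in bb'; case: (boolP (b \in H)) => bH.
    by have := z'att b bH; rewrite bb'.
  have bc : b \in c by apply: contraNT bH; apply: Hnbr aH ab.
  case: (eqVneq v b) => [->|vb]; first by apply: ball_mono (ball1 bb').
  by have := z'far b a bc vb aH ab; rewrite bb'.
(* The vertex [r], between [v] and [z'], has [x], [sc v] and [z] within distance 2. *)
case/ball_cons: z'v2 => [Ez'|[r vr z'r]]; first by rewrite Ez' eqxx in z'v.
have rv : e r v by rewrite e_sym.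
have zr : z \in ball e 2 r by apply: ball_step z'r _; rewrite e_sym.
have so : sc v \in ball e 2 r by apply: ball2 rv (succ_adj vc).
suff sz2 : sc v \in ball e 2 z.
  by have := far w h z wc vw hH hw (ball1 wz); rewrite sz2.
case: (eqVneq (sc v) z) => [<-|sz]; first exact: ball_refl.
case: (boolP (e (sc v) z)) => [ez|sNz].
  by apply: ball_mono (ball1 _) => //; rewrite e_sym.
(* Otherwise the triple [x], [sc v], [z] with centre [r] yields |X(x)| >= 3. *)
apply: contraT => sz2.
have nc : ~~ common (sc v) z by apply: contra sz2 => /common_ball.
have := degree_sum_outside xH (notH _ (succs_in sW)) zH (succs_notH sW xH)
  (zatt x xH) sNz sz (ball2 rv vx) so zr.
have := @degree_count_disjoint _ _ r (H :&: ball e 3 r) so zr nc.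
have E a : a \in H :&: ball e 3 r ->
    [/\ a \in ball e 3 r, ~~ e (sc v) a & ~~ e z a].
  by case/setIP=> aH ao; split=> //; rewrite e_sym;
    [apply: succs_notH | apply: zatt].
move/(_ E); have := small x xH.
by move: (deg e _) (deg e _) #|_| #|_| #|_|; clear; lia.
Qed.

End LongestCycle.

(** * The component of an edge off the cycle, and the final contradiction *)

Theorem theorem7 (T : finType) (e : rel T)
    (e_sym : symmetric e) (e_irr : irreflexive e)
    (G_conn : connected_on e [set: T])
    (G_ge3 : 3 <= #|T|)
    (ball3_conn : forall u : T, k_connected_on e 2 (ball e 3 u))
    (deg_sum : forall v x y z : T,
       x \in ball e 2 v -> y \in ball e 2 v -> z \in ball e 2 v ->
       x != y -> x != z -> y != z ->
       ~~ e x y -> ~~ e x z -> ~~ e y z ->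
       #|ball e 3 v| + 2 <= deg e x + deg e y + deg e z) :
  forall c : seq T, longest_cycle e c -> dominating e c.
Proof.
move=> c c_longest x0 y0 x0c y0c; apply/negP => xy0.
pose r := induced e [set z | z \notin c].
pose H := [set z | connect r x0 z].
have r_sym : symmetric r.
  by move=> a b; rewrite /r /induced /= e_sym andbCA.
have x0H : x0 \in H by rewrite inE.
have Hc z : z \in H -> z \notin c.
  rewrite inE => /connectP[p + ->]; elim/last_ind: p => [|p a _] //.
  by rewrite rcons_path last_rcons => /andP[_ /and3P[_ + _]]; rewrite inE.
have Hnbr z w : z \in H -> e z w -> w \notin c -> w \in H.
  move=> zH zw wc; have zc := Hc z zH; rewrite inE in zH; rewrite inE.
  by apply: connect_trans zH (connect1 _); rewrite /r /induced /= !inE zc wc.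
have Hpath x y : x \in H -> y \in H -> exists p,
    [/\ path e x p, uniq (x :: p), last x p = y & {subset x :: p <= H}].
  rewrite !inE => x0x x0y.
  have /connectP[p pp ->] : connect r x y.
    by apply: connect_trans x0y; rewrite (sym_connect_sym r_sym).
  case/shortenP: pp => q pq uq _; exists q; split=> //.
    by apply: sub_path pq => a b /and3P[].
  move=> z zq; rewrite inE; apply: connect_trans x0x _.
  exact: path_connect pq _ zq.
have y0H : y0 \in H by apply: Hnbr x0H xy0 y0c.
have [[_ c3] _] := c_longest.
have [a ac] : exists a, a \in c.
  have /hasP[a ac _] : has predT c by rewrite has_predT; apply: ltnW (ltnW c3).
  by exists a.
have aH : a \notin H by apply: contraL ac; apply: Hc.
(* Since G is connected, an edge leaves H; its outer end must lie on [c]. *)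
have [z [v [/and3P[_ _ zv] zH vH]]] :=
  connect_exit (G_conn _ _ (in_setT x0) (in_setT a)) x0H aH.
have vc : v \in c by apply: contraNT vH; apply: Hnbr zH zv.
have [x xH X1] := attach_two e_sym e_irr c_longest Hc Hnbr Hpath deg_sum
  ball3_conn zH vc zv.
(* H contains both [x0] and [y0], so a path inside H leads from [x] to another vertex; its first
   step gives [y]. *)
have [y yH xy] : exists2 y, y \in H & e x y.
  have [w wH xw] : exists2 w, w \in H & x != w.
    case: (eqVneq x x0) => [->|xx0]; last by exists x0.
    by exists y0 => //; apply: contraTneq xy0 => ->; rewrite e_irr.
  have [[|b p] [/= pp _ lp pH]] := Hpath x w xH wH.
    by rewrite lp eqxx in xw.
  case/andP: pp => xb _; exists b => //.
  by apply: pH; rewrite !inE eqxx orbT.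
have Y1 := attach_neighbor e_sym e_irr c_longest Hc Hnbr Hpath deg_sum
  xH yH xy X1.
exact: (attach_adjacent e_sym e_irr c_longest Hc Hnbr Hpath deg_sum
  xH yH xy X1 Y1).
Qed.
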